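(* Let $\Phi\subseteq\{I,O,U\}$, let $\mathcal I$ be a finite fuzzy interpretation, and let $\mathcal I/_{\approx}$ be the quotient fuzzy interpretation of $\mathcal I$ w.r.t. its strong $\Phi$-bisimilarity relation $\approx$. Then: (1) $\mathcal I/_{\approx}$ validates exactly the same fuzzy GCIs in $\mathcal L^{\sim}_\Phi$ as $\mathcal I$, and every fuzzy interpretation that validates exactly the same fuzzy GCIs in $\mathcal L^{\sim}_\Phi$ as $\mathcal I$ has a domain of cardinality at least $|\Delta^{\mathcal I/_{\approx}}|$; (2) if $\mathsf{IN}\ne\emptyset$ and either $U\in\Phi$ or $\mathcal I$ is connected w.r.t. $\Phi$, then: (a) $\mathcal I/_{\approx}$ is strongly $\Phi$-bisimilar to $\mathcal I$, and every fuzzy interpretation strongly $\Phi$-bisimilar to $\mathcal I$ has a domain of cardinality at least $|\Delta^{\mathcal I/_{\approx}}|$; (b) $\mathcal I/_{\approx}$ validates exactly the same fuzzy assertions of the form $C(a)\bowtie p$ in $\mathcal L^{\sim}_\Phi$ as $\mathcal I$, and every fuzzy interpretation validating exactly the same such assertions as $\mathcal I$ has a domain of cardinality at least $|\Delta^{\mathcal I/_{\approx}}|$.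
   Context: Gödel operations on $[0,1]$: $p\otimes q=\min\{p,q\}$, $p\oplus q=\max\{p,q\}$, $\ominus p=1$ if $p=0$ and $0$ otherwise, $(p\Rightarrow q)=1$ if $p\le q$ and $q$ otherwise, $(p\Leftrightarrow q)=(p\Rightarrow q)\otimes(q\Rightarrow p)$. Fix pairwise disjoint sets $\mathsf{CN}$, $\mathsf{RN}$, $\mathsf{IN}$ of concept, role and individual names. A basic role w.r.t. $\Phi$ is $r\in\mathsf{RN}$, or $r^-$ when $I\in\Phi$. Roles and concepts of $\mathcal L^{\sim}_\Phi$: each $r\in\mathsf{RN}$ is a role; if $R,S$ are roles and $C$ a concept then $R\circ S$, $R\sqcup S$, $R^*$, $C?$ are roles; $R^-$ if $I\in\Phi$; $U$ if $U\in\Phi$; concepts: $p\in[0,1]$, $A\in\mathsf{CN}$, $C\sqcap D$, $C\to D$, $\neg C$, $C\sqcup D$, $\mathord{\sim}C$, $\forall R.C$, $\exists R.C$; $\{a\}$ ($a\in\mathsf{IN}$) if $O\in\Phi$. $\top$ is concept $1$. A fuzzy interpretation $\mathcal I$ has a nonempty domain $\Delta^{\mathcal I}$, $a^{\mathcal I}\in\Delta^{\mathcal I}$, $A^{\mathcal I}:\Delta^{\mathcal I}\to[0,1]$, $r^{\mathcal I}:(\Delta^{\mathcal I})^2\to[0,1]$, extended by: $U^{\mathcal I}\equiv1$; $(R^-)^{\mathcal I}(x,y)=R^{\mathcal I}(y,x)$; $(C?)^{\mathcal I}(x,y)=C^{\mathcal I}(x)$ if $x=y$, else $0$; $(R\circ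 S)^{\mathcal I}(x,y)=\sup_z R^{\mathcal I}(x,z)\otimes S^{\mathcal I}(z,y)$; $(R\sqcup S)^{\mathcal I}=R^{\mathcal I}\oplus S^{\mathcal I}$; $(R^* )^{\mathcal I}(x,y)=\sup\{\min(\{1\}\cup\{R^{\mathcal I}(x_i,x_{i+1})\mid i<n\})\mid n\ge0,x_0=x,x_n=y\}$; $p^{\mathcal I}(x)=p$; $\{a\}^{\mathcal I}(x)=1$ iff $x=a^{\mathcal I}$, else $0$; $(\neg C)^{\mathcal I}=\ominus C^{\mathcal I}$; $(\mathord{\sim}C)^{\mathcal I}(x)=1-C^{\mathcal I}(x)$; $\sqcap,\sqcup,\to$ pointwise by $\otimes,\oplus,\Rightarrow$; $(\exists R.C)^{\mathcal I}(x)=\sup_y R^{\mathcal I}(x,y)\otimes C^{\mathcal I}(y)$; $(\forall R.C)^{\mathcal I}(x)=\inf_y(R^{\mathcal I}(x,y)\Rightarrow C^{\mathcal I}(y))$. $\mathcal I$ is finite if $\Delta^{\mathcal I}$, $\mathsf{CN}$, $\mathsf{RN}$, $\mathsf{IN}$ are finite. $\mathcal I$ is connected w.r.t. $\Phi$ if for every $x\in\Delta^{\mathcal I}$ there exist $a\in\mathsf{IN}$, $x_0,\dots,x_n$ and basic roles $R_1,\dots,R_n$ with $x_0=a^{\mathcal I}$, $x_n=x$, $R_i^{\mathcal I}(x_{i-1},x_i)>0$ for all $i$. A fuzzy assertion $C(a)\bowtie p$ ($C$ a concept of $\mathcal L^{\sim}_\Phi$, $a\in\mathsf{IN}$, $\bowtie\in\{\ge,>,\le,<\}$,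 $p\in[0,1]$) is validated iff $C^{\mathcal I}(a^{\mathcal I})\bowtie p$. A fuzzy GCI in $\mathcal L^{\sim}_\Phi$ is $(C\sqsubseteq D)\rhd p$ ($\rhd\in\{\ge,>\}$, $p\in(0,1]$), validated iff $(C\to D)^{\mathcal I}(x)\rhd p$ for all $x$. A crisp $\Phi$-bisimulation (for $\Phi\subseteq\{I,O,U\}$) between $\mathcal I,\mathcal I'$ is $Z:\Delta^{\mathcal I}\times\Delta^{\mathcal I'}\to\{0,1\}$ such that for all $x,x'$, $A\in\mathsf{CN}$, $a\in\mathsf{IN}$ and basic roles $R$: (i) $Z(x,x')\le(A^{\mathcal I}(x)\Leftrightarrow A^{\mathcal I'}(x'))$; (ii) $\forall y\exists y'$: $Z(x,x')\otimes R^{\mathcal I}(x,y)\le Z(y,y')\otimes R^{\mathcal I'}(x',y')$; (iii) $\forall y'\exists y$: $Z(x,x')\otimes R^{\mathcal I'}(x',y')\le Z(y,y')\otimes R^{\mathcal I}(x,y)$; (iv) if $O\in\Phi$: $Z(x,x')=0$ whenever exactly one of $x=a^{\mathcal I}$, $x'=a^{\mathcal I'}$ holds; (v) if $U\in\Phi$: $\forall y\exists y'$ $Z(x,x')\le Z(y,y')$ and $\forall y'\exists y$ $Z(x,x')\le Z(y,y')$. $\mathcal I,\mathcal I'$ are strongly $\Phi$-bisimilar if $\mathsf{IN}\ne\emptyset$ and some crisp $\Phi$-bisimulation $Z$ has $Z(a^{\mathcal I},a^{\mathcal I'})=1$ for all $a\in\mathsf{IN}$. The strong $\Phi$-bisimilarity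 relation $\approx$ of $\mathcal I$: $x\approx x'$ iff some crisp $\Phi$-bisimulation $Z$ between $\mathcal I$ and itself has $Z(x,x')=1$; it is an equivalence relation; $[x]$ denotes the class of $x$. The quotient $\mathcal I/_{\approx}$ has domain $\{[x]\mid x\in\Delta^{\mathcal I}\}$, $a^{\mathcal I/_{\approx}}=[a^{\mathcal I}]$, $A^{\mathcal I/_{\approx}}([x])=A^{\mathcal I}(x)$, $r^{\mathcal I/_{\approx}}([x],[y])=\sup\{r^{\mathcal I}(x,y')\mid y'\in[y]\}$ (independent of representatives). *)

(* Defs.v *)
From mathcomp Require Import all_boot all_order all_algebra.
From mathcomp Require Import all_classical all_reals.

Set Implicit Arguments.
Unset Strict Implicit.
Unset Printing Implicit Defensive.

Import Order.TTheory GRing.Theory Num.Theory.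
Local Open Scope classical_set_scope.
Local Open Scope ring_scope.

Section Goedel.
Context {R : realType}.
Implicit Types p q : R.

Definition gand p q : R := Num.min p q.
Definition gor p q : R := Num.max p q.
Definition gneg p : R := if p == 0 then 1 else 0.
Definition gimp p q : R := if p <= q then 1 else q.
Definition giff p q : R := gand (gimp p q) (gimp q p).

End Goedel.

(* I, O, U: inverse roles, nominals, universal role. *)
Inductive feature := featI | featO | featU.

(* The three sets of names are separate types, hence pairwise disjoint. The
   constructors that are only available when a feature belongs to Phi take a
   (boolean, hence proof-irrelevant) membership proof as an argument. *)
Inductive role (R : realType) (CN RN IN : Type) (Phi : pred feature) : Type :=
| RName of RN
| RComp of role R CN RN IN Phi & role R CN RN IN Phi
| RUnion of role R CN RN IN Phi & role R CN RN IN Phi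
| RStar of role R CN RN IN Phi
| RTest of concept R CN RN IN Phi
| RInv of Phi featI & role R CN RN IN Phi
| RUniv of Phi featU
with concept (R : realType) (CN RN IN : Type) (Phi : pred feature) : Type :=
| CConst (p : R) of 0 <= p <= 1
| CName of CN
| CAnd of concept R CN RN IN Phi & concept R CN RN IN Phi
| CImp of concept R CN RN IN Phi & concept R CN RN IN Phi
| CNeg of concept R CN RN IN Phi
| COr of concept R CN RN IN Phi & concept R CN RN IN Phi
| CInvol of concept R CN RN IN Phi
| CForall of role R CN RN IN Phi & concept R CN RN IN Phi
| CExists of role R CN RN IN Phi & concept R CN RN IN Phi
| CNominal of Phi featO & IN.

Record interp (R : realType) (CN RN IN : Type) := Interp {
  dom : Type;
  dom_inhabited : inhabited dom;
  iname : IN -> dom;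
  cname : CN -> dom -> R;
  rname : RN -> dom -> dom -> R;
  cname01 : forall A x, 0 <= cname A x <= 1;
  rname01 : forall r x y, 0 <= rname r x y <= 1 }.

Section Semantics.
Context {R : realType} {CN RN IN : Type} {Phi : pred feature}.
Local Notation role := (role R CN RN IN Phi).
Local Notation concept := (concept R CN RN IN Phi).
Local Notation interp := (interp R CN RN IN).

(* A path x_0, ..., x_n is given by the first n.+1 terms of a sequence; the
   minimum is 1 when n = 0. *)
Definition star (T : Type) (f : T -> T -> R) (x y : T) : R :=
  sup [set v | exists n (s : nat -> T), [/\ s 0%N = x, s n = y &
    v = \big[Num.min/1]_(i < n) f (s i) (s i.+1)]].

Fixpoint role_sem (I : interp) (Q : role) : dom I -> dom I -> R :=
  match Q with
  | RName r => rname r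
  | RComp Q1 Q2 => fun x y =>
      sup [set gand (role_sem Q1 x z) (role_sem Q2 z y) | z in [set: dom I]]
  | RUnion Q1 Q2 => fun x y => gor (role_sem Q1 x y) (role_sem Q2 x y)
  | RStar Q1 => star (@role_sem I Q1)
  | RTest C => fun x y => if `[< x = y >] then concept_sem C x else 0
  | RInv _ Q1 => fun x y => role_sem Q1 y x
  | RUniv _ => fun _ _ => 1
  end
with concept_sem (I : interp) (C : concept) : dom I -> R :=
  match C with
  | CConst p _ => fun _ => p
  | CName A => cname A
  | CAnd C1 C2 => fun x => gand (concept_sem C1 x) (concept_sem C2 x)
  | CImp C1 C2 => fun x => gimp (concept_sem C1 x) (concept_sem C2 x)
  | CNeg C1 => fun x => gneg (concept_sem C1 x)
  | COr C1 C2 => fun x => gor (concept_sem C1 x) (concept_sem C2 x)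
  | CInvol C1 => fun x => 1 - concept_sem C1 x
  | CForall Q C1 => fun x =>
      inf [set gimp (role_sem Q x y) (concept_sem C1 y) | y in [set: dom I]]
  | CExists Q C1 => fun x =>
      sup [set gand (role_sem Q x y) (concept_sem C1 y) | y in [set: dom I]]
  | CNominal _ a => fun x => if `[< x = iname I a >] then 1 else 0
  end.

Definition is_basic (Q : role) : bool :=
  match Q with
  | RName _ => true
  | RInv _ (RName _) => true
  | _ => false
  end.

End Semantics.

Definition finite_interp (R : realType) (CN RN IN : Type)
    (I : interp R CN RN IN) : Prop :=
  [/\ finite_set [set: dom I], finite_set [set: CN], finite_set [set: RN]
    & finite_set [set: IN]].

Definition connected_interp (R : realType) (CN RN IN : Type)
    (Phi : pred feature) (I : interp R CN RN IN) : Prop :=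
  forall x : dom I, exists (a : IN) (n : nat) (s : nat -> dom I)
      (Q : nat -> role R CN RN IN Phi),
    [/\ s 0%N = iname I a, s n = x &
      forall i : nat, (i < n)%N ->
        is_basic (Q i) /\ 0 < role_sem (Q i) (s i) (s i.+1)].

Inductive cmp := cmpGe | cmpGt | cmpLe | cmpLt.

Definition cmp_sem (R : realType) (o : cmp) (u p : R) : bool :=
  match o with
  | cmpGe => u >= p
  | cmpGt => u > p
  | cmpLe => u <= p
  | cmpLt => u < p
  end.

Definition is_lower (o : cmp) : bool :=
  match o with cmpGe | cmpGt => true | cmpLe | cmpLt => false end.

Record assertion (R : realType) (CN RN IN : Type) (Phi : pred feature) :=
  Assertion {
  as_concept : concept R CN RN IN Phi;
  as_name : IN;
  as_cmp : cmp;
  as_deg : R;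
  as_deg01 : 0 <= as_deg <= 1 }.

Record gci (R : realType) (CN RN IN : Type) (Phi : pred feature) := Gci {
  gci_lhs : concept R CN RN IN Phi;
  gci_rhs : concept R CN RN IN Phi;
  gci_cmp : cmp;
  gci_deg : R;
  gci_cmp_lower : is_lower gci_cmp;
  gci_deg01 : 0 < gci_deg <= 1 }.

Section Validity.
Context {R : realType} {CN RN IN : Type}.
Local Notation interp := (interp R CN RN IN).

Definition validates_assertion Phi (I : interp)
    (t : assertion R CN RN IN Phi) : Prop :=
  cmp_sem (as_cmp t) (concept_sem (as_concept t) (iname I (as_name t)))
    (as_deg t).

Definition validates_gci Phi (I : interp) (g : gci R CN RN IN Phi) : Prop :=
  forall x : dom I,
    cmp_sem (gci_cmp g) (concept_sem (CImp (gci_lhs g) (gci_rhs g)) x)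
      (gci_deg g).

Definition same_assertions (Phi : pred feature) (I J : interp) : Prop :=
  forall t : assertion R CN RN IN Phi,
    validates_assertion I t <-> validates_assertion J t.

Definition same_gcis (Phi : pred feature) (I J : interp) : Prop :=
  forall g : gci R CN RN IN Phi, validates_gci I g <-> validates_gci J g.

End Validity.

Section Bisimulation.
Context {R : realType} {CN RN IN : Type} (Phi : pred feature).
Local Notation role := (role R CN RN IN Phi).
Local Notation interp := (interp R CN RN IN).

Record crisp_bisim (I J : interp) (Z : dom I -> dom J -> bool) : Prop :=
  CrispBisim {
  bisim_cname : forall x x' (A : CN),
    (Z x x')%:R <= giff (cname A x) (cname A x');
  bisim_forth : forall x x' (Q : role), is_basic Q -> forall y, exists y',
    gand (Z x x')%:R (role_sem Q x y) <= gand (Z y y')%:R (role_sem Q x' y');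
  bisim_back : forall x x' (Q : role), is_basic Q -> forall y', exists y,
    gand (Z x x')%:R (role_sem Q x' y') <= gand (Z y y')%:R (role_sem Q x y);
  bisim_nominal : Phi featO -> forall x x' (a : IN),
    (x = iname I a /\ x' <> iname J a) \/ (x <> iname I a /\ x' = iname J a) ->
    Z x x' = false;
  bisim_univ_forth : Phi featU -> forall x x' y, exists y',
    ((Z x x')%:R : R) <= (Z y y')%:R;
  bisim_univ_back : Phi featU -> forall x x' y', exists y,
    ((Z x x')%:R : R) <= (Z y y')%:R }.

Definition strongly_bisimilar (I J : interp) : Prop :=
  inhabited IN /\ exists Z : dom I -> dom J -> bool,
    crisp_bisim Z /\ forall a : IN, Z (iname I a) (iname J a) = true.

Definition sbisim (I : interp) (x x' : dom I) : Prop :=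
  exists Z : dom I -> dom I -> bool, crisp_bisim Z /\ Z x x' = true.

Lemma gand_boolP (b c : bool) (u v : R) : 0 <= u <= 1 -> 0 <= v <= 1 ->
  (gand b%:R u <= gand c%:R v) <-> (b -> u <= v /\ (0 < u -> c)).
Proof.
move=> /andP[u0 u1] /andP[v0 v1]; rewrite /gand.
case: b; last first.
  by rewrite min_l//; split=> // _; rewrite le_min v0 andbT; case: c.
rewrite min_r//; case: c; first by rewrite min_r//; split=> [h _//|/(_ isT)[]].
rewrite min_l//; split=> [h _|/(_ isT)[_ h]]; last first.
  by rewrite leNgt; apply/negP => /h.
by split; [exact: le_trans v0 | rewrite ltNge h].
Qed.

Lemma giff_boolP (b : bool) (p q : R) : 0 <= p <= 1 -> 0 <= q <= 1 ->
  (b%:R <= giff p q) <-> (b -> p = q).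
Proof.
move=> /andP[p0 p1] /andP[q0 q1]; rewrite /giff /gand /gimp; split; last first.
  case: b => [/(_ isT)->|_]; first by rewrite lexx minxx.
  by rewrite le_min; do 2!case: ifP => _; rewrite ?ler01 ?p0 ?q0.
move=> + b1; rewrite b1; case: (ltgtP p q) => // pq.
- by rewrite le_min => /andP[_]; rewrite leNgt (lt_le_trans pq).
- by rewrite le_min => /andP[]; rewrite leNgt (lt_le_trans pq).
Qed.

Lemma is_basic_sem01 (I : interp) (Q : role) (x y : dom I) :
  is_basic Q -> 0 <= role_sem Q x y <= 1.
Proof.
by case: Q => //= [r|_ []//= r] _; exact: rname01.
Qed.

Lemma gand_basicP (I J : interp) (Q : role) (b c : bool) (x y : dom I)
    (x' y' : dom J) : is_basic Q ->
  (gand b%:R (role_sem Q x y) <= gand c%:R (role_sem Q x' y')) <->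
  (b -> role_sem Q x y <= role_sem Q x' y' /\ (0 < role_sem Q x y -> c)).
Proof. by move=> bQ; apply: gand_boolP; exact: is_basic_sem01. Qed.

Lemma sbisim_refl (I : interp) (x : dom I) : sbisim x x.
Proof.
exists (fun x y => `[< x = y >]); split; last exact/asboolP.
split=> [y y' A|y y' Q bQ z|y y' Q bQ z|_ y y' a h|_ y y'|_ y y'].
- by apply/giff_boolP; try exact: cname01; move=> /asboolP ->.
- exists z; apply/(gand_basicP _ _ _ _ _ _ bQ).
  by move=> /asboolP ->; split=> // _; exact/asboolP.
- exists z; apply/(gand_basicP _ _ _ _ _ _ bQ).
  by move=> /asboolP ->; split=> // _; exact/asboolP.
- by apply/asboolP => yy'; move: h; rewrite yy' => -[[]|[]].
- by move=> z; exists z; rewrite (asboolT (erefl z)); case: asboolP.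
- by move=> z; exists z; rewrite (asboolT (erefl z)); case: asboolP.
Qed.

Lemma sbisim_sym (I : interp) (x x' : dom I) : sbisim x x' -> sbisim x' x.
Proof.
move=> [Z [[h1 h2 h3 h4 h5 h6] Zx]].
exists (fun x y => Z y x); split=> //; split=> //.
- move=> y y' A; have := h1 y' y A.
  by rewrite /giff /gand minC.
- by move=> y y' Q bQ z; have [z' ?] := h3 y' y Q bQ z; exists z'.
- by move=> y y' Q bQ z; have [z' ?] := h2 y' y Q bQ z; exists z'.
- by move=> fO y y' a h; apply: (h4 fO _ _ a); case: h => -[]; [right|left].
- by move=> fU y y' z; have [z' ?] := h6 fU y' y z; exists z'.
- by move=> fU y y' z; have [z' ?] := h5 fU y' y z; exists z'.
Qed.

Lemma sbisim_trans (I : interp) (x y z : dom I) :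
  sbisim x y -> sbisim y z -> sbisim x z.
Proof.
move=> [Z [[h1 h2 h3 h4 h5 h6] Zxy]] [W [[k1 k2 k3 k4 k5 k6] Wyz]].
exists (fun a b => `[< exists c, Z a c /\ W c b >]); split; last first.
  by apply/asboolP; exists y.
split=> [a b A|a b Q bQ a'|a b Q bQ b'|fO a b n h|fU a b a'|fU a b b'].
- apply/giff_boolP; try exact: cname01.
  move=> /asboolP[c [Zac Wcb]].
  move/giff_boolP: (h1 a c A) => -> //; try exact: cname01.
  by move/giff_boolP: (k1 c b A) => -> //; exact: cname01.
- have [[c [Zac Wcb]]|nc] := pselect (exists c, Z a c /\ W c b); last first.
    exists b; apply/(gand_basicP _ _ _ _ _ _ bQ).
    by move=> /asboolP.
  have [c' /(gand_basicP _ _ _ _ _ _ bQ)/(_ Zac)[ac Zc']] := h2 a c Q bQ a'.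
  have [b' /(gand_basicP _ _ _ _ _ _ bQ)/(_ Wcb)[cb Wb']] := k2 c b Q bQ c'.
  exists b'; apply/(gand_basicP _ _ _ _ _ _ bQ).
  move=> _; split; first exact: le_trans cb.
  move=> a0; apply/asboolP; exists c'; split; first exact: Zc'.
  by apply: Wb'; exact: lt_le_trans ac.
- have [[c [Zac Wcb]]|nc] := pselect (exists c, Z a c /\ W c b); last first.
    exists a; apply/(gand_basicP _ _ _ _ _ _ bQ).
    by move=> /asboolP.
  have [c' /(gand_basicP _ _ _ _ _ _ bQ)/(_ Wcb)[cb Wb']] := k3 c b Q bQ b'.
  have [a' /(gand_basicP _ _ _ _ _ _ bQ)/(_ Zac)[ac Zc']] := h3 a c Q bQ c'.
  exists a'; apply/(gand_basicP _ _ _ _ _ _ bQ).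
  move=> _; split; first exact: le_trans ac.
  move=> b0; apply/asboolP; exists c'; split; last exact: Wb'.
  by apply: Zc'; exact: lt_le_trans cb.
- apply/asboolP => -[c [Zac Wcb]].
  have [cn|cn] := pselect (c = iname I n); case: h => -[an bn].
  + by rewrite (k4 fO c b n) in Wcb => //; left.
  + by rewrite (h4 fO a c n) in Zac => //; right.
  + by rewrite (h4 fO a c n) in Zac => //; left.
  + by rewrite (k4 fO c b n) in Wcb => //; right.
- case: asboolP => [[c [Zac Wcb]]|_]; last by exists a'.
  have [c'] := h5 fU a c a'; rewrite Zac; case Zc': (Z a' c'); last first.
    by rewrite ler10.
  have [b'] := k5 fU c b c'; rewrite Wcb; case Wb': (W c' b'); last first.
    by rewrite ler10.
  by exists b'; rewrite asboolT//; exists c'.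
- case: asboolP => [[c [Zac Wcb]]|_]; last by exists b'.
  have [c'] := k6 fU c b b'; rewrite Wcb; case Wb': (W c' b'); last first.
    by rewrite ler10.
  have [a'] := h6 fU a c c'; rewrite Zac; case Zc': (Z a' c'); last first.
    by rewrite ler10.
  by exists a'; rewrite asboolT//; exists c'.
Qed.

Definition sclass (I : interp) (x : dom I) : set (dom I) :=
  [set x' | sbisim x x'].

Lemma sclassP (I : interp) (x y : dom I) : sclass x = sclass y <-> sbisim x y.
Proof.
split=> [xy|xy].
  have : sclass y y by exact: sbisim_refl.
  by rewrite -xy.
apply/seteqP; split=> z /=; last exact: sbisim_trans.
by apply: sbisim_trans; exact: sbisim_sym.
Qed.

Definition qdom (I : interp) : Type :=
  {c : set (dom I) | exists x, c = sclass x}.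

Definition qclass (I : interp) (x : dom I) : qdom I :=
  exist _ (sclass x) (ex_intro _ x erefl).

(* A chosen representative; quotient_cnameE and quotient_rnameE below show that
   the quotient does not depend on the choice. *)
Definition qrepr (I : interp) (c : qdom I) : dom I :=
  projT1 (cid (proj2_sig c)).

Definition qrname (I : interp) (r : RN) (c d : qdom I) : R :=
  sup [set rname r (qrepr c) y' | y' in proj1_sig d].

Lemma qdom_inhabited (I : interp) : inhabited (qdom I).
Proof. by case: (dom_inhabited I) => x; exact: (inhabits (qclass x)). Qed.

Lemma qrname01 (I : interp) r (c d : qdom I) : 0 <= qrname r c d <= 1.
Proof.
rewrite /qrname; case: d => D /= [x ->].
have ub1 : ubound [set rname r (qrepr c) y' | y' in sclass x] 1.
  by move=> _ [y _ <-]; case/andP: (rname01 r (qrepr c) y).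
have x_in : [set rname r (qrepr c) y' | y' in sclass x] (rname r (qrepr c) x).
  by exists x => //; exact: sbisim_refl.
apply/andP; split; last by apply: ge_sup => //; eexists; exact: x_in.
apply: le_trans (ub_le_sup _ x_in); last by exists 1.
by case/andP: (rname01 r (qrepr c) x).
Qed.

Definition quotient (I : interp) : interp :=
  {| dom := qdom I;
     dom_inhabited := qdom_inhabited I;
     iname := fun a => qclass (iname I a);
     cname := fun A c => cname A (qrepr c);
     rname := @qrname I;
     cname01 := fun A c => cname01 A (qrepr c);
     rname01 := @qrname01 I |}.

Lemma qrepr_sbisim (I : interp) (x : dom I) : sbisim (qrepr (qclass x)) x.
Proof. by rewrite /qrepr; case: cid => y /= /esym/sclassP. Qed.

Lemma quotient_cnameE (I : interp) (A : CN) (x : dom I) :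
  cname A (qclass x : dom (quotient I)) = cname A x.
Proof.
have [Z [bZ Zx]] := qrepr_sbisim x.
by have /giff_boolP := bisim_cname bZ (qrepr (qclass x)) x A;
  apply; try exact: cname01.
Qed.

Lemma quotient_rnameE (I : interp) (r : RN) (x y : dom I) :
  rname r (qclass x : dom (quotient I)) (qclass y) =
  sup [set rname r x y' | y' in sclass y].
Proof.
have le_sup_sbisim u v : sbisim u v ->
    sup [set rname r u y' | y' in sclass y] <=
    sup [set rname r v y' | y' in sclass y].
  move=> [Z [bZ Zuv]]; apply: ge_sup.
    by eexists; exists y; [exact: sbisim_refl|reflexivity].
  have ubv : has_ubound [set rname r v y' | y' in sclass y].
    by exists 1 => _ [z _ <-]; case/andP: (rname01 r v z).
  move=> _ [y' yy' <-].
  pose Q : role := RName R CN IN Phi r.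
  have bQ : is_basic Q by [].
  have [v' /(gand_basicP _ _ _ _ _ _ bQ)/(_ Zuv)[uv Zv']] :=
    bisim_forth bZ u v bQ y'.
  have [u0|u0] := ltP 0 (rname r u y').
    apply: le_trans uv _; apply: ub_le_sup => //; exists v' => //.
    by apply: sbisim_trans yy' _; exists Z; split=> //; exact: Zv'.
  apply: (le_trans u0); apply: (@le_trans _ _ (rname r v y)).
    by case/andP: (rname01 r v y).
  by apply: ub_le_sup => //; exists y => //; exact: sbisim_refl.
apply/eqP; rewrite eq_le; apply/andP; split; apply: le_sup_sbisim.
  exact: qrepr_sbisim.
by apply: sbisim_sym; exact: qrepr_sbisim.
Qed.

End Bisimulation.

(* Main.v *)
(* Concepts are invariant under crisp bisimulations, and the graph of the
   projection onto the quotient is one; so I and its quotient agree on GCIs and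
   assertions.  Over a finite domain the involutive negation and the truth
   constants yield, for every x, a concept E_x with value 1 at x, such that E_x
   and E_y are contradictory unless x and y are indistinguishable by concepts.
   Hence (Hennessy-Milner) indistinguishable individuals are bisimilar.  Every
   J that realizes with positive degree each concept realized in I then has
   pairwise distinct witnesses of the E_x, one for each bisimilarity class.
   Realization is transferred to J by the GCI [(1 <= ~C) >= 1], or, for
   assertions, by prefixing C with [exists U] or with the roles along a path
   from a named individual. *)
Require Import Defs.
From mathcomp Require Import all_boot all_order all_algebra.
From mathcomp Require Import all_classical all_reals.

Set Implicit Arguments.
Unset Strict Implicit.
Unset Printing Implicit Defensive.

Import Order.TTheory GRing.Theory Num.Theory.
Local Open Scope classical_set_scope.
Local Open Scope ring_scope.
Local Open Scope card_scope.

(* Joint induction on roles and concepts; cardinality preliminaries *)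
Scheme role_concept_ind := Induction for role Sort Prop
with concept_role_ind := Induction for concept Sort Prop.
Combined Scheme syntax_ind from role_concept_ind, concept_role_ind.

Lemma inj_setT_card_le (T U : Type) (f : T -> U) :
  injective f -> [set: T] #<= [set: U].
Proof.
move=> f_inj; have [g] : $|{injfun [set: T] >-> [set: U]}|.
  by apply/injfunPex; exists f => // x y _ _; exact: f_inj.
exact: inj_card_le.
Qed.

(** The alias [{classic T}] supplies the decidable equality that membership in a sequence
    requires. *)
Lemma finite_setT_seq (T : Type) : finite_set [set: T] ->
  exists s : seq {classic T}, forall x, x \in s.
Proof.
move=> /(@finite_seqP {classic T})[s sT]; exists s => x.
by have : [set: {classic T}] x by []; rewrite sT.
Qed.

(** * Strict thresholds and bounds for the Gödel operations, suprema and path values *)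

Section Goedel.
Context {R : realType}.
Implicit Types (p q t : R) (A : set R).

(** For empty [A] the default [sup set0 = 0] and [0 <= t] make both sides false, so one equivalence
    covers all cases. *)
Lemma sup_gtP A t : 0 <= t -> ubound A 1 ->
  (t < sup A) <-> (exists2 v, A v & t < v).
Proof.
move=> t0 A1; split=> [|[v Av tv]]; last first.
  by apply: (lt_le_trans tv); apply: ub_le_sup => //; exists 1.
have [->|/set0P A0] := eqVneq A set0; first by rewrite sup0 ltNge t0.
exact: sup_gt.
Qed.

Lemma sup_itv01 A : (forall v, A v -> 0 <= v <= 1) -> 0 <= sup A <= 1.
Proof.
move=> A01; have [->|/set0P[v Av]] := eqVneq A set0.
  by rewrite sup0 lexx ler01.
have A1 : ubound A 1 by move=> u /A01/andP[].
apply/andP; split; last by apply: ge_sup => //; exists v.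
by apply: le_trans (ub_le_sup _ Av); [case/andP: (A01 v Av)|exists 1].
Qed.

Lemma inf_itv01 A : A !=set0 -> (forall v, A v -> 0 <= v <= 1) ->
  0 <= inf A <= 1.
Proof.
move=> [v Av] A01; apply/andP; split.
  by apply: lb_le_inf; [exists v|move=> u /A01/andP[]].
apply: le_trans (ge_inf _ Av) _; last by case/andP: (A01 v Av).
by exists 0 => u /A01/andP[].
Qed.

(** If [q < p], then [q] itself would be a threshold that violates the assumption. *)
Lemma le_gtP p q : 0 <= q -> (forall t, 0 <= t -> t < p -> t < q) -> p <= q.
Proof.
by move=> q0 pq; rewrite leNgt; apply/negP => /(pq _ q0); rewrite ltxx.
Qed.

Lemma ge_ltP p q : q <= 1 -> (forall t, t <= 1 -> p < t -> q < t) -> q <= p.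
Proof.
by move=> q1 pq; rewrite leNgt; apply/negP => /(pq _ q1); rewrite ltxx.
Qed.

Lemma gand_gtP t p q : t < gand p q <-> t < p /\ t < q.
Proof. by rewrite /gand lt_min; split=> /andP. Qed.

Lemma gand_itv01 p q : 0 <= p <= 1 -> 0 <= q <= 1 -> 0 <= gand p q <= 1.
Proof. by rewrite /gand /Order.min; case: ifP. Qed.

Lemma gor_itv01 p q : 0 <= p <= 1 -> 0 <= q <= 1 -> 0 <= gor p q <= 1.
Proof. by rewrite /gor /Order.max; case: ifP. Qed.

Lemma gimp_itv01 p q : 0 <= q <= 1 -> 0 <= gimp p q <= 1.
Proof. by rewrite /gimp; case: ifP; rewrite ?lexx ?ler01. Qed.

Lemma gneg_itv01 p : 0 <= gneg p <= 1.
Proof. by rewrite /gneg; case: ifP; rewrite lexx ler01. Qed.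

Lemma onem_itv01 p : 0 <= p <= 1 -> 0 <= 1 - p <= 1.
Proof. by move=> /andP[p0 p1]; rewrite subr_ge0 p1 gerBl p0. Qed.

Lemma star_set_itv01 (T : Type) (f : T -> T -> R) x y :
  (forall u v, 0 <= f u v <= 1) ->
  forall w, [set w | exists n (s : nat -> T), [/\ s 0%N = x, s n = y &
    w = \big[Num.min/1]_(i < n) f (s i) (s i.+1)]] w -> 0 <= w <= 1.
Proof.
move=> f01 _ [n [s [_ _ ->]]].
elim/big_ind : _ => [|p q|//]; [by rewrite ler01 lexx|exact: gand_itv01].
Qed.

(** The conjunct [t < 1] reflects the starting value 1 of the minimum, which is all that remains
    when [n = 0]. *)
Lemma star_gtP (T : Type) (f : T -> T -> R) x y t :
  (forall u v, 0 <= f u v <= 1) -> 0 <= t ->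
  t < star f x y <-> t < 1 /\ exists n (s : nat -> T),
    [/\ s 0%N = x, s n = y & forall i, (i < n)%N -> t < f (s i) (s i.+1)].
Proof.
move=> f01 t0; rewrite /star sup_gtP//; last first.
  by move=> w /(star_set_itv01 f01)/andP[].
split=> [[_ [n [s [s0 sn ->]]] /bigmin_gtP[t1 ts]]|[t1 [n [s [s0 sn ts]]]]].
  by split=> //; exists n, s; split=> // i lin; exact: (ts (Ordinal lin)).
eexists; first by exists n, s; split.
by apply/bigmin_gtP; split=> // i _; exact: ts.
Qed.

Lemma star_flip (T : Type) (f : T -> T -> R) x y t :
  (forall u v, 0 <= f u v <= 1) -> 0 <= t ->
  t < star f x y <-> t < star (fun u v => f v u) y x.
Proof.
(* Flipping twice gives back the function, so one implication, for arbitrary [g], yields both. *)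
have rev (g : T -> T -> R) u v : (forall u v, 0 <= g u v <= 1) -> 0 <= t ->
    t < star g u v -> t < star (fun a b => g b a) v u.
  move=> g01 t0 /(star_gtP _ _ g01 t0)[t1 [n [s [s0 sn ts]]]].
  apply/star_gtP => //; split=> //; exists n, (fun i => s (n - i)%N).
  rewrite subn0 subnn; split=> // i lin.
  (* Since [n - i = (n - i.+1).+1], step [i] of the reversed path is edge [n - i.+1] of [s]
     traversed backwards. *)
  rewrite -(subnSK lin); apply: ts.
  by rewrite ltn_subrL (leq_ltn_trans (leq0n i) lin).
by move=> f01 t0; split; exact: rev.
Qed.

End Goedel.

(** * Truth values lie in the unit interval; thresholds for the quantifiers *)

Section Range.
Context {R : realType} {CN RN IN : Type} {Phi : pred feature}.
Variable I : interp R CN RN IN.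

Lemma sem_itv01 :
  (forall (Q : role R CN RN IN Phi) (x y : dom I), 0 <= role_sem Q x y <= 1) /\
  (forall (C : concept R CN RN IN Phi) (x : dom I), 0 <= concept_sem C x <= 1).
Proof.
have [x0] := dom_inhabited I.
apply: (@syntax_ind R CN RN IN Phi
  (fun Q => forall x y : dom I, 0 <= role_sem Q x y <= 1)
  (fun C => forall x : dom I, 0 <= concept_sem C x <= 1)) => //=.
- by move=> r x y; exact: rname01.
- by move=> Q IHQ S IHS x y; apply: sup_itv01 => _ [z _ <-]; exact: gand_itv01.
- by move=> Q IHQ S IHS x y; exact: gor_itv01.
- by move=> Q IHQ x y; apply: sup_itv01 => w; exact: star_set_itv01.
- by move=> C IHC x y; case: asboolP => _ //; rewrite lexx ler01.
- by move=> _ x y; rewrite lexx ler01.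
- by move=> A x; exact: cname01.
- by move=> C IHC D IHD x; exact: gand_itv01.
- by move=> C IHC D IHD x; exact: gimp_itv01.
- by move=> C IHC x; exact: gneg_itv01.
- by move=> C IHC D IHD x; exact: gor_itv01.
- by move=> C IHC x; exact: onem_itv01.
- move=> Q IHQ C IHC x; apply: inf_itv01.
    by eexists; exists x0.
  by move=> _ [y _ <-]; exact: gimp_itv01.
- by move=> Q IHQ C IHC x; apply: sup_itv01 => _ [y _ <-]; exact: gand_itv01.
- by move=> _ a x; case: asboolP; rewrite lexx ler01.
Qed.

Definition role_itv01 := sem_itv01.1.
Definition concept_itv01 := sem_itv01.2.

Lemma concept_exists_gtP (Q : role R CN RN IN Phi) C (x : dom I) t : 0 <= t ->
  t < concept_sem (CExists Q C) x <->
  exists2 y, t < role_sem Q x y & t < concept_sem C y.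
Proof.
move=> t0 /=; rewrite sup_gtP//; last first.
  move=> _ [y _ <-].
  by case/andP: (gand_itv01 (role_itv01 Q x y) (concept_itv01 C y)).
split=> [[_ [y _ <-] /gand_gtP[]]|[y tQ tC]]; first by exists y.
by eexists; [exists y|apply/gand_gtP; split].
Qed.

(** A Gödel implication is below [t <= 1] only where its conclusion is strictly below its premise,
    and there it equals the conclusion. *)
Lemma concept_forall_ltP (Q : role R CN RN IN Phi) C (x : dom I) t : t <= 1 ->
  concept_sem (CForall Q C) x < t <->
  exists2 y, concept_sem C y < role_sem Q x y & concept_sem C y < t.
Proof.
move=> t1 /=; have [x0] := dom_inhabited I; split.
  case/inf_lt => [|_ [y _ <-]]; first by eexists; exists x0.
  rewrite /gimp; case: (leP (role_sem Q x y)) => [_|QC Ct].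
    by rewrite ltNge t1.
  by exists y.
move=> [y QC Ct]; apply: le_lt_trans Ct.
apply: ge_inf; last by exists y; rewrite // /gimp leNgt QC.
exists 0 => _ [z _ <-].
by case/andP: (gimp_itv01 (role_sem Q x z) (concept_itv01 C z)).
Qed.

End Range.

(* Strict thresholds t < f x y pass through suprema without any attainment, so
   invariance needs no finiteness. *)
Definition zig (R : realType) (T T' : Type) (P : T -> T' -> Prop)
    (f : T -> T -> R) (g : T' -> T' -> R) : Prop :=
  forall x x' y t, P x x' -> 0 <= t -> t < f x y ->
    exists2 y', P y y' & t < g x' y'.

(** * Closure of the zigzag condition under the role constructors *)

Section Zig.
Context {R : realType} {T T' : Type}.
Variable P : T -> T' -> Prop.
Implicit Types (f : T -> T -> R) (g : T' -> T' -> R).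

Lemma zig_gor f1 f2 g1 g2 : zig P f1 g1 -> zig P f2 g2 ->
  zig P (fun x y => gor (f1 x y) (f2 x y)) (fun x y => gor (g1 x y) (g2 x y)).
Proof.
move=> h1 h2 x x' y t Pxx' t0; rewrite /gor lt_max => /orP[tf|tf].
  have [y' Py tg] := h1 _ _ _ _ Pxx' t0 tf.
  by exists y' => //; rewrite lt_max tg.
have [y' Py tg] := h2 _ _ _ _ Pxx' t0 tf.
by exists y' => //; rewrite lt_max tg orbT.
Qed.

Lemma zig_comp f1 f2 g1 g2 :
  (forall x y, f1 x y <= 1) -> (forall x y, g1 x y <= 1) ->
  zig P f1 g1 -> zig P f2 g2 ->
  zig P (fun x y => sup [set gand (f1 x z) (f2 z y) | z in [set: T]])
        (fun x y => sup [set gand (g1 x z) (g2 z y) | z in [set: T']]).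
Proof.
have gand1 (p q : R) : p <= 1 -> gand p q <= 1.
  by move=> p1; rewrite /gand ge_min p1.
move=> f1le1 g1le1 h1 h2 x x' y t Pxx' t0 /sup_gtP[//||].
  by move=> _ [z _ <-]; exact: gand1.
move=> _ [z _ <-] /gand_gtP[tf1 tf2].
have [z' Pz tg1] := h1 _ _ _ _ Pxx' t0 tf1.
have [y' Py tg2] := h2 _ _ _ _ Pz t0 tf2.
exists y' => //; apply/sup_gtP => //; first by move=> _ [w _ <-]; exact: gand1.
by eexists; [exists z'|apply/gand_gtP; split].
Qed.

Lemma zig_star f g :
  (forall x y, 0 <= f x y <= 1) -> (forall x y, 0 <= g x y <= 1) ->
  zig P f g -> zig P (star f) (star g).
Proof.
move=> f01 g01 h x x' y t Pxx' t0 /star_gtP[//|//|t1 [n [s [s0 sn ts]]]].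
(* The path is copied edge by edge at the fixed threshold [t]; the endpoint [s' n] is whatever the
   last step yields. *)
suff [s' [s'0 Ps' ts']] : exists s', [/\ s' 0%N = x',
    P (s n) (s' n) & forall i, (i < n)%N -> t < g (s' i) (s' i.+1)].
  exists (s' n); first by rewrite -sn.
  by apply/star_gtP => //; split=> //; exists n, s'.
elim: n {sn} ts => [_|n IHn ts].
  by exists (fun=> x'); rewrite s0; split.
have [i lin|s' [s'0 Ps' ts']] := IHn; first by apply: ts; exact: ltnW.
have [z Pz tz] := h _ _ _ _ Ps' t0 (ts n (ltnSn n)).
exists (fun i => if (i <= n)%N then s' i else z); split=> //.
  by rewrite ltnn.
move=> i; rewrite ltnS leq_eqVlt => /predU1P[->|lin] /=.
  by rewrite eqxx ltnn.
by rewrite lin orbT; exact: ts'.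
Qed.

Lemma zig_flip_star f g :
  (forall x y, 0 <= f x y <= 1) -> (forall x y, 0 <= g x y <= 1) ->
  zig P (fun x y => f y x) (fun x y => g y x) ->
  zig P (fun x y => star f y x) (fun x y => star g y x).
Proof.
move=> f01 g01 h x x' y t Pxx' t0 /star_flip-/(_ f01 t0) tf.
have [y' Py tg] := zig_star (fun u v => f01 v u) (fun u v => g01 v u) h
  Pxx' t0 tf.
by exists y' => //; apply/star_flip.
Qed.

(** The converse of a composition is the composition of the converses in reverse order, up to
    commutativity of [gand]. *)
Lemma zig_flip_comp f1 f2 g1 g2 :
  (forall x y, f2 x y <= 1) -> (forall x y, g2 x y <= 1) ->
  zig P (fun x y => f1 y x) (fun x y => g1 y x) ->
  zig P (fun x y => f2 y x) (fun x y => g2 y x) ->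
  zig P (fun x y => sup [set gand (f1 y z) (f2 z x) | z in [set: T]])
        (fun x y => sup [set gand (g1 y z) (g2 z x) | z in [set: T']]).
Proof.
move=> f21 g21 h1 h2 x x' y t Pxx' t0 tf.
have [|y' Py tg] := @zig_comp (fun x y => f2 y x) (fun x y => f1 y x)
  (fun x y => g2 y x) (fun x y => g1 y x)
  (fun u v => f21 v u) (fun u v => g21 v u) h2 h1 x x' y t Pxx' t0.
  by congr (_ < sup _): tf; apply: eq_imagel => z _; exact: minC.
exists y' => //; congr (_ < sup _): tg.
by apply: eq_imagel => z _; exact: minC.
Qed.

Lemma zig_test (h : T -> R) (h' : T' -> R) :
  (forall x x', P x x' -> h x = h' x') ->
  zig P (fun x y => if `[< x = y >] then h x else 0)
        (fun x y => if `[< x = y >] then h' x else 0).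
Proof.
move=> hh' x x' y t Pxx' t0; case: asboolP => [<-|_]; last by rewrite ltNge t0.
by move=> th; exists x' => //; rewrite asboolT// -(hh' _ _ Pxx').
Qed.

Lemma zig_flip_test (h : T -> R) (h' : T' -> R) :
  (forall x x', P x x' -> h x = h' x') ->
  zig P (fun x y => if `[< y = x >] then h y else 0)
        (fun x y => if `[< y = x >] then h' y else 0).
Proof.
move=> hh' x x' y t Pxx' t0; case: asboolP => [->|_]; last by rewrite ltNge t0.
by move=> th; exists x' => //; rewrite asboolT// -(hh' _ _ Pxx').
Qed.

End Zig.

(** * Invariance of concepts under crisp bisimulations *)

Section Invariance.
Context {R : realType} {CN RN IN : Type} {Phi : pred feature}.
Implicit Types I J : interp R CN RN IN.
Local Notation role := (role R CN RN IN Phi).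
Local Notation concept := (concept R CN RN IN Phi).
Local Notation sem I Q := (@role_sem R CN RN IN Phi I Q).

(** The bisimulation condition gives a [y'] with at least the same role degree; [0 <= t] makes that
    degree positive, which forces [Z y y']. *)
Lemma bisim_zig I J (Z : dom I -> dom J -> bool) (Q : role) :
  crisp_bisim Phi Z -> is_basic Q ->
  zig Z (sem I Q) (sem J Q).
Proof.
move=> bZ bQ x x' y t Zxx' t0 tQ.
have [y' /(gand_basicP _ _ _ _ _ _ bQ)/(_ Zxx')[xx' Zy]] :=
  bisim_forth bZ x x' bQ y.
exists y'; last exact: lt_le_trans xx'.
by apply: Zy; exact: le_lt_trans tQ.
Qed.

Lemma crisp_bisim_sym I J (Z : dom I -> dom J -> bool) :
  crisp_bisim Phi Z -> crisp_bisim Phi (fun y x => Z x y).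
Proof.
move=> [h1 h2 h3 h4 h5 h6]; split=> //.
- by move=> y y' A; have := h1 y' y A; rewrite /giff /gand minC.
- by move=> y y' Q bQ z; have [z' ?] := h3 y' y Q bQ z; exists z'.
- by move=> y y' Q bQ z; have [z' ?] := h2 y' y Q bQ z; exists z'.
- by move=> fO y y' a h; apply: (h4 fO _ _ a); case: h => -[]; [right|left].
- by move=> fU y y' z; have [z' ?] := h6 fU y' y z; exists z'.
- by move=> fU y y' z; have [z' ?] := h5 fU y' y z; exists z'.
Qed.

Lemma bisim_univ I J (Z : dom I -> dom J -> bool) x x' y :
  crisp_bisim Phi Z -> Phi featU -> Z x x' -> exists y', Z y y'.
Proof.
move=> bZ fU Zxx'; have [y'] := bisim_univ_forth bZ fU x x' y.
by rewrite Zxx'; case Zy: (Z y y'); [exists y'|rewrite ler10].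
Qed.

Lemma bisim_iname I J (Z : dom I -> dom J -> bool) x x' a :
  crisp_bisim Phi Z -> Phi featO -> Z x x' -> x = iname I a <-> x' = iname J a.
Proof.
move=> bZ fO Zxx'; have nZ := bisim_nominal bZ fO (x := x) (x' := x') (a := a).
split=> e; apply: contrapT => ne.
  by rewrite nZ in Zxx' => //; left.
by rewrite nZ in Zxx' => //; right.
Qed.

(* The converse of a role is only available as a role when I is in Phi, so the
   converse zigzag conditions are carried along under that proviso. *)
Definition zigzag I J (Z : dom I -> dom J -> bool) (Q : role) : Prop :=
  [/\ zig Z (sem I Q) (sem J Q),
      zig (fun y x => Z x y) (sem J Q) (sem I Q) &
      Phi featI ->
        zig Z (fun x y => sem I Q y x) (fun x y => sem J Q y x) /\
        zig (fun y x => Z x y) (fun x y => sem J Q y x)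
          (fun x y => sem I Q y x)].

Lemma bisim_sem I J (Z : dom I -> dom J -> bool) : crisp_bisim Phi Z ->
  (forall Q : role, zigzag Z Q) /\
  (forall (C : concept) x x', Z x x' -> concept_sem C x = concept_sem C x').
Proof.
move=> bZ; have bZ' := crisp_bisim_sym bZ.
have r01 (K : interp R CN RN IN) (Q : role) (x y : dom K) := role_itv01 Q x y.
have r1 (K : interp R CN RN IN) (Q : role) (x y : dom K) : role_sem Q x y <= 1.
  by case/andP: (r01 _ Q x y).
apply: (@syntax_ind R CN RN IN Phi (zigzag Z)
  (fun C => forall x x', Z x x' -> concept_sem C x = concept_sem C x')) => //=.
- move=> r; split.
  + exact: (@bisim_zig _ _ _ (RName _ _ _ _ r) bZ isT).
  + exact: (@bisim_zig _ _ _ (RName _ _ _ _ r) bZ' isT).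
  + move=> fI; split.
      exact: (@bisim_zig _ _ _ (RInv fI (RName _ _ _ _ r)) bZ isT).
    exact: (@bisim_zig _ _ _ (RInv fI (RName _ _ _ _ r)) bZ' isT).
- move=> Q [q1 q2 q3] S [s1 s2 s3]; split; [exact: zig_comp..|].
  move=> fI; have [q4 q5] := q3 fI; have [s4 s5] := s3 fI.
  by split; exact: zig_flip_comp.
- move=> Q [q1 q2 q3] S [s1 s2 s3]; split; [exact: zig_gor..|].
  move=> fI; have [q4 q5] := q3 fI; have [s4 s5] := s3 fI.
  by split; [exact: (zig_gor q4 s4)|exact: (zig_gor q5 s5)].
- move=> Q [q1 q2 q3]; split; [exact: zig_star..|].
  by move=> /q3[q4 q5]; split; exact: zig_flip_star.
- move=> C hC; have hC' x x' : Z x' x -> concept_sem C x = concept_sem C x'.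
    by move=> /hC.
  split; [exact: zig_test..|].
  by move=> _; split; exact: zig_flip_test.
- by move=> fI Q [q1 q2 /(_ fI)[q3 q4]]; split.
- have zU (K L : interp R CN RN IN) (W : dom K -> dom L -> bool) :
      crisp_bisim Phi W -> Phi featU -> zig W (fun _ _ => 1 : R) (fun _ _ => 1).
    move=> bW fU x x' y t Wxx' _ t1.
    by have [y' Wy] := bisim_univ y bW fU Wxx'; exists y'.
  by move=> fU; split; [exact: zU|exact: zU|split; exact: zU].
- move=> A x x' Zxx'; have /giff_boolP := bisim_cname bZ x x' A.
  by apply; try exact: cname01.
- by move=> C hC D hD x x' Zxx'; rewrite (hC _ _ Zxx') (hD _ _ Zxx').
- by move=> C hC D hD x x' Zxx'; rewrite (hC _ _ Zxx') (hD _ _ Zxx').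
- by move=> C hC x x' Zxx'; rewrite (hC _ _ Zxx').
- by move=> C hC D hD x x' Zxx'; rewrite (hC _ _ Zxx') (hD _ _ Zxx').
- by move=> C hC x x' Zxx'; rewrite (hC _ _ Zxx').
(* One inequality, stated for any relation [W], is enough: [Z] gives one direction and its converse
   the other. *)
- suff le (K L : interp R CN RN IN) (W : dom K -> dom L -> bool)
      (Q : role) (C : concept) x x' :
      zig W (sem K Q) (sem L Q) ->
      (forall x x', W x x' -> concept_sem C x = concept_sem C x') -> W x x' ->
      concept_sem (CForall Q C) x' <= concept_sem (CForall Q C) x.
    move=> Q [q1 q2 _] C hC x x' Zxx'; apply/le_anti/andP; split.
      by apply: (le _ _ (fun y x => Z x y) Q C) => // y y' /hC.
    exact: (le _ _ Z Q C).
  move=> zQ hC Wxx'; apply: ge_ltP.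
    by case/andP: (concept_itv01 (CForall Q C) x').
  move=> t t1 /(concept_forall_ltP _ _ _ t1)[y CQ Ct].
  (* The value of [C] at [y] serves as the threshold at which the role is followed. *)
  have C0 : 0 <= concept_sem C y by case/andP: (concept_itv01 C y).
  have [y' Wy CQ'] := zQ _ _ _ _ Wxx' C0 CQ.
  by apply/concept_forall_ltP => //; exists y'; rewrite -(hC _ _ Wy).
- suff le (K L : interp R CN RN IN) (W : dom K -> dom L -> bool)
      (Q : role) (C : concept) x x' :
      zig W (sem K Q) (sem L Q) ->
      (forall x x', W x x' -> concept_sem C x = concept_sem C x') -> W x x' ->
      concept_sem (CExists Q C) x <= concept_sem (CExists Q C) x'.
    move=> Q [q1 q2 _] C hC x x' Zxx'; apply/le_anti/andP; split.
      exact: (le _ _ Z Q C).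
    by apply: (le _ _ (fun y x => Z x y) Q C) => // y y' /hC.
  move=> zQ hC Wxx'; apply: le_gtP.
    by case/andP: (concept_itv01 (CExists Q C) x').
  move=> t t0 /(concept_exists_gtP _ _ _ t0)[y tQ tC].
  have [y' Wy tQ'] := zQ _ _ _ _ Wxx' t0 tQ.
  by apply/concept_exists_gtP => //; exists y'; rewrite -?(hC _ _ Wy).
- move=> fO a x x' Zxx'; have xa := bisim_iname a bZ fO Zxx'.
  by congr (if _ then _ else _); apply/asbool_equiv_eq.
Qed.

Definition concept_invariance I J Z (bZ : @crisp_bisim _ _ _ _ Phi I J Z) :=
  (bisim_sem bZ).2.

Lemma strongly_bisimilar_assertions I J :
  strongly_bisimilar Phi I J -> same_assertions Phi I J.
Proof.
move=> [_ [Z [bZ Za]]] [C a o p p01].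
by rewrite /validates_assertion /= (concept_invariance bZ C (Za a)).
Qed.

End Invariance.

(** A maximizer [m] of [g] on [P] works: if [g m < u], then [g m] would be a threshold that no point
    of [P] exceeds. This replaces witnesses depending on [t], as in [zig], by the single witness
    that a crisp bisimulation asks for. *)
Lemma finite_attained (R : realType) (T : Type) (P : set T) (g : T -> R) u :
  finite_set P -> 0 < u ->
  (forall t, 0 <= t -> t < u -> exists2 y, P y & t < g y) ->
  exists2 y, P y & u <= g y.
Proof.
move=> finP u0 above; have [y0 Py0 gy0] := above 0 (lexx 0) u0.
have [m Pm gm] : exists2 m, P m & forall y, P y -> g y <= g m.
  have [s Ps] := (@finite_seqP {classic T} P).1 finP.
  move: Py0; rewrite {}Ps => {finP above gy0}.
  elim: s y0 => // a s IHs y0 _.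
  have [[y ys]|s0] := pselect (exists y, [set` s] y); last first.
    exists a => [|y]; rewrite /= inE ?eqxx// => /predU1P[->//|ys].
    by case: s0; exists y.
  have [m ms gm] := IHs _ ys; have [am|ma] := leP (g a) (g m).
    exists m => [|z]; rewrite /= inE ?(ms : m \in s) ?orbT//.
    by move=> /predU1P[->//|]; exact: gm.
  exists a => [|z]; rewrite /= inE ?eqxx// => /predU1P[->//|zs].
  by apply: le_trans (ltW ma); exact: gm.
exists m => //; rewrite leNgt; apply/negP => gmu.
have [|y Py] := above _ _ gmu; last by rewrite ltNge gm.
by apply: le_trans (ltW gy0) _; exact: gm.
Qed.

(** * Crisp bisimulations between finite domains, and the projection onto the quotient *)

Section FiniteBisimulation.
Context {R : realType} {CN RN IN : Type} {Phi : pred feature}.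
Implicit Types I J : interp R CN RN IN.
Local Notation role := (role R CN RN IN Phi).
Local Notation concept := (concept R CN RN IN Phi).
Local Notation sem I Q := (@role_sem R CN RN IN Phi I Q).

Lemma crisp_bisim_zig I J (P : dom I -> dom J -> Prop) :
  finite_set [set: dom I] -> finite_set [set: dom J] ->
  (forall x x' A, P x x' -> cname A x = cname A x') ->
  (forall Q : role, is_basic Q ->
    zig P (sem I Q) (sem J Q)) ->
  (forall Q : role, is_basic Q ->
    zig (fun x' x => P x x') (sem J Q) (sem I Q)) ->
  (Phi featO -> forall x x' a, P x x' -> x = iname I a <-> x' = iname J a) ->
  (Phi featU -> forall x x' y, P x x' -> exists y', P y y') ->
  (Phi featU -> forall x x' y', P x x' -> exists y, P y y') ->
  crisp_bisim Phi (fun x x' => `[< P x x' >]).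
Proof.
move=> finI finJ hA forth back hO hU hU'; split.
- by move=> x x' A; apply/giff_boolP; try exact: cname01; move=> /asboolP/hA.
- move=> x x' Q bQ y; have [Pxx'|nP] := pselect (P x x'); last first.
    by exists x'; apply/(gand_basicP _ _ _ _ _ _ bQ) => /asboolP.
  (* When the role degree is 0 nothing has to be related, so any point, here [x'], is a witness. *)
  have [Q0|Q0] := ltP 0 (role_sem Q x y); last first.
    exists x'; apply/(gand_basicP _ _ _ _ _ _ bQ) => _.
    rewrite ltNge Q0; split=> //; apply: (le_trans Q0).
    by case/andP: (role_itv01 Q x' x').
  have [|t t0 tQ|y' Py le] :=
      finite_attained (P := P y) (g := role_sem Q x') _ Q0.
  + exact: sub_finite_set finJ.
  + exact: (forth Q bQ _ _ _ _ Pxx').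
  exists y'; apply/(gand_basicP _ _ _ _ _ _ bQ) => _.
  by split=> // _; exact/asboolP.
- move=> x x' Q bQ y'; have [Pxx'|nP] := pselect (P x x'); last first.
    by exists x; apply/(gand_basicP _ _ _ _ _ _ bQ) => /asboolP.
  have [Q0|Q0] := ltP 0 (role_sem Q x' y'); last first.
    exists x; apply/(gand_basicP _ _ _ _ _ _ bQ) => _.
    rewrite ltNge Q0; split=> //; apply: (le_trans Q0).
    by case/andP: (role_itv01 Q x x).
  have [|t t0 tQ|y Py le] :=
      finite_attained (P := fun y => P y y') (g := role_sem Q x) _ Q0.
  + exact: sub_finite_set finI.
  + exact: (back Q bQ _ _ _ _ Pxx').
  exists y; apply/(gand_basicP _ _ _ _ _ _ bQ) => _.
  by split=> // _; exact/asboolP.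
- move=> fO x x' a xa; apply/asboolP => /(hO fO _ _ a) e.
  by case: xa => -[xa x'a]; [case: x'a|case: xa]; exact/e.
- move=> fU x x' y; case: asboolP => [Pxx'|_]; last by exists x'.
  by have [y' Py] := hU fU _ _ y Pxx'; exists y'; rewrite asboolT.
- move=> fU x x' y'; case: asboolP => [Pxx'|_]; last by exists x.
  by have [y Py] := hU' fU _ _ y' Pxx'; exists y; rewrite asboolT.
Qed.

Lemma qclassP I (x y : dom I) : qclass Phi x = qclass Phi y <-> sbisim Phi x y.
Proof.
split=> [|xy]; last by apply: eq_exist; exact/sclassP.
by move=> [/sclassP].
Qed.

Lemma qclass_qrepr I (c : qdom Phi I) : c = qclass Phi (qrepr c).
Proof. by case: c => D h; apply: eq_exist; exact: (projT2 (cid h)). Qed.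

Lemma quotient_rname_gtP I r (x y : dom I) t : 0 <= t ->
  t < rname r (qclass Phi x : dom (quotient Phi I)) (qclass Phi y) <->
  exists2 y', sbisim Phi y y' & t < rname r x y'.
Proof.
move=> t0; rewrite quotient_rnameE sup_gtP//; last first.
  by move=> _ [z _ <-]; case/andP: (rname01 r x z).
split=> [[_ [z yz <-]]|[z yz tz]]; first by exists z.
by eexists; first exists z.
Qed.

Lemma quotient_bisim I : finite_set [set: dom I] ->
  crisp_bisim Phi
    (fun (c : dom (quotient Phi I)) (x : dom I) => `[< c = qclass Phi x >]).
Proof.
move=> finI; apply: crisp_bisim_zig => //.
- apply: sub_finite_set (finite_image (@qclass _ _ _ _ Phi I) finI).
  by move=> c _; exists (qrepr c) => //; rewrite -qclass_qrepr.
- by move=> _ x A ->; exact: quotient_cnameE.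
- move=> Q bQ c x d t -> t0; rewrite (qclass_qrepr d); set y := qrepr d.
  case: Q bQ => // [r _|fI []// r _] /=.
    move=> /(quotient_rname_gtP _ _ _ t0)[y' /qclassP yy' ty'].
    by exists y'.
  (* The supremum in the quotient runs over the second argument of [r], which for an inverse role is
     the class of [x]. A bisimulation from [x'] to [x] moves the edge to [x] itself, replacing [y]
     by an equivalent [y']. *)
  move=> /(quotient_rname_gtP _ _ _ t0)[x' /sbisim_sym[Z [bZ Zxx']] tx'].
  have [y' Zy ty'] :=
    bisim_zig (Q := RInv fI (RName _ _ _ _ r)) bZ isT Zxx' t0 tx'.
  by exists y' => //; apply/qclassP; exists Z.
- move=> Q bQ x c y t -> t0 tQ; exists (qclass Phi y) => //.
  case: Q bQ tQ => // [r _|fI []// r _] /= tr.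
    by apply/quotient_rname_gtP => //; exists y => //; exact: sbisim_refl.
  by apply/quotient_rname_gtP => //; exists x => //; exact: sbisim_refl.
- move=> fO _ x a -> /=; split=> [/qclassP[Z [bZ Zxa]]|->//].
  exact/(bisim_iname a bZ fO Zxa).
(* The universal role only asks that the projection be surjective and total. *)
- by move=> _ _ x c _; exists (qrepr c); exact: qclass_qrepr.
- by move=> _ _ x y _; exists (qclass Phi y).
Qed.

Lemma quotient_concept I (C : concept) (x : dom I) : finite_set [set: dom I] ->
  concept_sem C (qclass Phi x : dom (quotient Phi I)) = concept_sem C x.
Proof.
move=> finI; apply: (concept_invariance (quotient_bisim finI)).
exact/asboolP.
Qed.

Lemma quotient_gcis I : finite_set [set: dom I] ->
  same_gcis Phi (quotient Phi I) I.
Proof.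
move=> finI [C D o p oL p01]; rewrite /validates_gci; split=> h x.
  by have := h (qclass Phi x); rewrite quotient_concept.
by rewrite (qclass_qrepr x) quotient_concept.
Qed.

Lemma quotient_strongly_bisimilar I : finite_set [set: dom I] -> inhabited IN ->
  strongly_bisimilar Phi (quotient Phi I) I.
Proof.
move=> finI IN0; split=> //; eexists; split; first exact: quotient_bisim.
by move=> a; exact/asboolP.
Qed.

End FiniteBisimulation.

(** * Characteristic concepts and the Hennessy-Milner property *)

Section Characteristic.
Context {R : realType} {CN RN IN : Type} {Phi : pred feature}.
Implicit Types I J : interp R CN RN IN.
Local Notation role := (role R CN RN IN Phi).
Local Notation concept := (concept R CN RN IN Phi).
Local Notation sem I Q := (@role_sem R CN RN IN Phi I Q).

Definition CTop : concept :=
  @CConst R CN RN IN Phi 1 (introT andP (conj ler01 (lexx 1))).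

Definition logic_equiv I (x y : dom I) : Prop :=
  forall C : concept, concept_sem C x = concept_sem C y.

(* [~~(C <-> p)] with the inner negation involutive and the outer one Goedel's
   is crisp: it is 1 exactly where C takes the value p. *)
Lemma separating_concept I (x y : dom I) : ~ logic_equiv x y ->
  exists S : concept, concept_sem S x = 1 /\ concept_sem S y = 0.
Proof.
move=> /existsNP[C /eqP Cxy].
pose p : concept := CConst CN RN IN Phi (concept_itv01 C x).
exists (CNeg (CInvol (CAnd (CImp C p) (CImp p C)))) => /=; split.
  by rewrite /gimp lexx /gand minxx subrr /gneg eqxx.
rewrite /gneg subr_eq0 eq_sym; case: eqP => // e.
have /andP[Cx0 Cx1] := concept_itv01 C x.
have /andP[Cy0 Cy1] := concept_itv01 C y.
have /(giff_boolP true (concept_itv01 C y) (concept_itv01 C x))/(_ isT)/eqP :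
  (true%:R : R) <= giff (concept_sem C y) (concept_sem C x) by rewrite /giff e.
by rewrite eq_sym (negbTE Cxy).
Qed.

(* E x is the conjunction of [S (x, y)] and [~S (y, x)] over all y that are not
   equivalent to x; hence E x and E y are contradictory as formulas, in every
   interpretation and not only in I. *)
Lemma characteristic_concepts I : finite_set [set: dom I] ->
  exists E : dom I -> concept, (forall x, concept_sem (E x) x = 1) /\
    forall x y J (z : dom J),
      0 < concept_sem (E x) z -> 0 < concept_sem (E y) z -> logic_equiv x y.
Proof.
move=> /finite_setT_seq[s sI].
(* One separating concept is fixed for each ordered pair; [CTop] is a dummy for equivalent pairs. *)
have /choice[S SP] : forall xy : dom I * dom I, exists S : concept,
    ~ logic_equiv xy.1 xy.2 -> concept_sem S xy.1 = 1 /\ concept_sem S xy.2 = 0.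
  move=> [x y] /=.
  have [xy|/separating_concept[S SP]] := pselect (logic_equiv x y).
    by exists CTop.
  by exists S.
pose G x y : concept := if `[< logic_equiv x y >] then CTop
  else CAnd (S (x, y)) (CNeg (S (y, x))).
pose E x : concept := foldr (fun y => CAnd (G x y)) CTop s.
exists E; split=> [x|x y J z Ex Ey].
  have Gx y : concept_sem (G x y) x = 1.
    rewrite /G; case: asboolP => //= xy.
    have [_ /= ->] := SP (y, x) (fun yx => xy (fun C => esym (yx C))).
    by have [/= -> _] := SP (x, y) xy; rewrite /gneg eqxx /gand minxx.
  by rewrite /E; elim: (s) => //= y s' ->; rewrite Gx /gand minxx.
(* Positivity of a conjunction passes to each conjunct, and [s] enumerates the whole domain. *)
have Gpos u v : 0 < concept_sem (E u) z -> 0 < concept_sem (G u v) z.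
  rewrite /E; elim: (s) (sI v) => // w s' IHs.
  by rewrite inE /= => + /gand_gtP[Gw Es] => /predU1P[->//|/IHs]; exact.
apply: contrapT => xy.
have yx : ~ logic_equiv y x by move=> h; apply: xy => C; rewrite h.
(* [E x] makes [S (x, y)] positive at [z], while [E y] contains its Gödel negation, which is then
   0. *)
have := Gpos _ y Ex; rewrite /G asboolF//= => /gand_gtP[Sxy _].
have := Gpos _ x Ey; rewrite /G asboolF//= => /gand_gtP[_].
by rewrite /gneg (gt_eqF Sxy) ltxx.
Qed.

(** The concept [CExists Q (E y)] exceeds [t] at [x], hence at [x']; a successor of [x'] witnessing
    this makes [E y] positive and is therefore equivalent to [y]. *)
Lemma logic_equiv_zig I (Q : role) : finite_set [set: dom I] ->
  zig (@logic_equiv I) (sem I Q) (sem I Q).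
Proof.
move=> /characteristic_concepts[E [E1 Ediff]] x x' y t xx' t0 tQ.
have : t < concept_sem (CExists Q (E y)) x.
  apply/concept_exists_gtP => //; exists y; rewrite // E1.
  by apply: lt_le_trans tQ _; case/andP: (role_itv01 Q x y).
rewrite xx' => /(concept_exists_gtP _ _ _ t0)[y' tQ' tE].
exists y' => //; apply: (Ediff y y' I y'); last by rewrite E1.
exact: le_lt_trans tE.
Qed.

Lemma logic_equiv_sbisim I (x x' : dom I) : finite_set [set: dom I] ->
  logic_equiv x x' -> sbisim Phi x x'.
Proof.
move=> finI xx'; exists (fun y y' => `[< logic_equiv y y' >]).
split; last exact/asboolP.
apply: crisp_bisim_zig => //.
- by move=> y y' A /(_ (CName _ _ _ _ A)).
- by move=> Q _; exact: logic_equiv_zig.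
- move=> Q _ y y' z t y'y t0 tQ.
  have [C|z' zz' tz'] := @logic_equiv_zig I Q finI y y' z t _ t0 tQ.
    by rewrite y'y.
  by exists z' => // C; rewrite zz'.
- move=> fO y y' a /(_ (CNominal _ _ _ fO a)) /=.
  do 2!case: asboolP => //; move=> _ _ /eqP; rewrite ?oner_eq0//.
  by rewrite eq_sym oner_eq0.
- by move=> _ _ _ y _; exists y.
- by move=> _ _ _ y _; exists y.
Qed.

(** * Lower bounds on the size of a domain by transfer of realized concepts *)

Lemma quotient_card_le I J : finite_set [set: dom I] ->
  (forall (C : concept) (x : dom I), 0 < concept_sem C x ->
    exists z : dom J, 0 < concept_sem C z) ->
  [set: dom (quotient Phi I)] #<= [set: dom J].
Proof.
move=> finI IJ; have [E [E1 Ediff]] := characteristic_concepts finI.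
have /choice[f fP] : forall c : qdom Phi I,
    exists z : dom J, 0 < concept_sem (E (qrepr c)) z.
  by move=> c; apply: (IJ _ (qrepr c)); rewrite E1.
(* A witness shared by two classes makes both characteristic concepts positive, so the
   representatives are equivalent and the classes coincide. *)
apply: (@inj_setT_card_le _ _ f) => c d fcd.
rewrite (qclass_qrepr c) (qclass_qrepr d).
apply/qclassP/logic_equiv_sbisim => //.
by apply: (Ediff _ _ J (f c) (fP c)); rewrite fcd; exact: fP.
Qed.

(** If [C] were 0 throughout [J], then [J] would validate that [CTop] is subsumed by [CNeg C] to
    degree 1; so would [I], although [CNeg C] is 0 at [x]. *)
Lemma same_gcis_positive I J (C : concept) (x : dom I) :
  same_gcis Phi J I -> 0 < concept_sem C x ->
  exists z : dom J, 0 < concept_sem C z.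
Proof.
move=> JI Cx; apply: contrapT => C0.
pose g : gci R CN RN IN Phi := @Gci R CN RN IN Phi CTop (CNeg C) cmpGe 1 isT
  (introT andP (conj ltr01 (lexx 1))).
have /(JI g)/(_ x) : validates_gci J g.
  move=> z /=; suff -> : concept_sem C z = 0 by rewrite /gneg eqxx /gimp lexx.
  have /andP[Cz _] := concept_itv01 C z; apply/le_anti; rewrite Cz andbT leNgt.
  by apply/negP => Cpos; apply: C0; exists z.
by rewrite /= /gneg (gt_eqF Cx) /gimp !ler10.
Qed.

(** [D] nests the existential restrictions along [Q 0], ..., [Q n.-1] around [C]. It is built from
    the syntax of the path alone, so it also leads to a point of [C] in any other interpretation. *)
Lemma reaching_concept I (n : nat) (s : nat -> dom I) (Q : nat -> role)
    (C : concept) :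
  (forall i, (i < n)%N -> 0 < role_sem (Q i) (s i) (s i.+1)) ->
  0 < concept_sem C (s n) ->
  exists2 D : concept, 0 < concept_sem D (s 0%N) &
    forall J (u : dom J), 0 < concept_sem D u ->
      exists z : dom J, 0 < concept_sem C z.
Proof.
elim: n C => [|n IHn] C Qpos Cpos; first by exists C => // J u; exists u.
have [||D Dpos DJ] := IHn (CExists (Q n) C).
- by move=> i /ltnW; exact: Qpos.
- by apply/concept_exists_gtP => //; exists (s n.+1) => //; exact: Qpos.
exists D => // J u /DJ[z /concept_exists_gtP[//|w _ Cw]].
by exists w.
Qed.

Lemma same_assertions_positive I J (C : concept) (x : dom I) :
  inhabited IN -> Phi featU \/ connected_interp Phi I ->
  same_assertions Phi J I ->
  0 < concept_sem C x -> exists z : dom J, 0 < concept_sem C z.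
Proof.
move=> [a0] reach JI Cx.
suff [a [D Dpos DJ]] : exists a, exists2 D : concept,
    0 < concept_sem D (iname I a) &
    forall u : dom J, 0 < concept_sem D u ->
      exists z : dom J, 0 < concept_sem C z.
  apply: DJ (iname J a) _.
  (* Positivity of [D] at a named individual is itself an assertion, with strict comparison and
     degree 0, and so carries over to [J]. *)
  pose g : assertion R CN RN IN Phi := @Assertion R CN RN IN Phi D a cmpGt 0
    (introT andP (conj (lexx 0) ler01)).
  exact: (JI g).2.
case: reach => [fU|conn].
  exists a0, (CExists (RUniv R CN RN IN fU) C).
    by apply/concept_exists_gtP => //; exists x => //=.
  by move=> u /concept_exists_gtP[//|z _ Cz]; exists z.
have [a [n [s [Q [s0 sn Qpos]]]]] := conn x; exists a.
have [|D Dpos DJ] := @reaching_concept I n s Q C (fun i lin => (Qpos i lin).2).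
  by rewrite sn.
by exists D; rewrite -?s0 // => u; exact: DJ.
Qed.

End Characteristic.

Theorem theorem11 (R : realType) (CN RN IN : Type) (Phi : pred feature)
    (I : interp R CN RN IN) (finI : finite_interp I) :
  (same_gcis Phi (quotient Phi I) I /\
   forall J : interp R CN RN IN, same_gcis Phi J I ->
     [set: dom (quotient Phi I)] #<= [set: dom J]) /\
  (inhabited IN -> Phi featU \/ connected_interp Phi I ->
   (strongly_bisimilar Phi (quotient Phi I) I /\
    forall J : interp R CN RN IN, strongly_bisimilar Phi J I ->
      [set: dom (quotient Phi I)] #<= [set: dom J]) /\
   (same_assertions Phi (quotient Phi I) I /\
    forall J : interp R CN RN IN, same_assertions Phi J I ->
      [set: dom (quotient Phi I)] #<= [set: dom J])).
Proof.
case: finI => finI _ _ _; split.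
  split=> [|J JI]; first exact: quotient_gcis.
  by apply: (quotient_card_le finI) => C x; exact: same_gcis_positive.
move=> IN0 reach.
(* Strong bisimilarity implies agreement on assertions, so this bound serves both (a) and (b). *)
have card_le J : same_assertions Phi J I ->
    [set: dom (quotient Phi I)] #<= [set: dom J].
  move=> JI; apply: (quotient_card_le finI) => C x.
  exact: same_assertions_positive.
have qI : strongly_bisimilar Phi (quotient Phi I) I.
  exact: quotient_strongly_bisimilar.
split; split=> //; last exact: strongly_bisimilar_assertions.
by move=> J /strongly_bisimilar_assertions/card_le.
Qed.
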